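(* If $V$ is a finite-dimensional irreducible $H$-module, then $V\simeq \Bbbk_{\gamma}$ for a unique $\gamma\in\mathbb{B}$.
   Context: $\Bbbk$ is an algebraically closed field of characteristic $0$. $H$ is the $\Bbbk$-algebra generated by $\mathbf{y}_1,\mathbf{y}_2,\mathbf{g}^{\pm1}$ with defining relations $\mathbf{g}\mathbf{g}^{-1}=\mathbf{g}^{-1}\mathbf{g}=1$, $\mathbf{y}_2\mathbf{y}_1-\mathbf{y}_1\mathbf{y}_2+\tfrac12\mathbf{y}_1^2=0$, $\mathbf{g}\mathbf{y}_1\mathbf{g}^{-1}=\mathbf{y}_1$, $\mathbf{g}\mathbf{y}_2\mathbf{g}^{-1}=\mathbf{y}_1+\mathbf{y}_2$ (the bosonization of the Jordan plane by the group algebra of an infinite cyclic group). $\mathbb{B}=\left\{\begin{pmatrix}a&b\\0&a^{-1}\end{pmatrix}: (a,b)\in\Bbbk^{\times}\times\Bbbk\right\}\le SL_2(\Bbbk)$. For $\gamma=\begin{pmatrix}a&b\\0&a^{-1}\end{pmatrix}\in\mathbb{B}$, $\Bbbk_\gamma=\Bbbk$ is the one-dimensional $H$-module where $\mathbf{y}_1$ acts by $0$, $\mathbf{g}$ by $a$ and $\mathbf{y}_2$ by $b$. Modules are left modules. *)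

(* Defs.v *)
From HB Require Import structures.
From mathcomp Require Import all_boot all_algebra.
From mathcomp Require Import boolp.
From mathcomp Require Import finmap.
From mathcomp.multinomials Require Import monalg.

Set Implicit Arguments.
Unset Strict Implicit.
Unset Printing Implicit Defensive.

Import GRing.Theory.
Local Open Scope ring_scope.
Local Open Scope quotient_scope.

(* Generated two-sided ideals; MathComp only has one-sided ones. *)
Section TwoSidedIdeal.
Variables (A : nzRingType) (rels : seq A).

Inductive in_ideal : A -> Prop :=
| in_ideal0 : in_ideal 0
| in_idealD x y : in_ideal x -> in_ideal y -> in_ideal (x + y)
| in_idealM a r b : r \in rels -> in_ideal (a * r * b).

Definition two_sided_ideal : {pred A} := [pred x | `[< in_ideal x >]].

Lemma two_sided_idealP x : reflect (in_ideal x) (x \in two_sided_ideal).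
Proof. exact: asboolP. Qed.

Lemma two_sided_ideal_closed : zmod_closed two_sided_ideal.
Proof.
split; first exact/two_sided_idealP/in_ideal0.
move=> x y /two_sided_idealP Ix /two_sided_idealP Iy.
apply/two_sided_idealP/in_idealD => //.
elim: Iy => [|u v _ IHu _ IHv|a r b rr]; first by rewrite oppr0; constructor.
  by rewrite opprD; apply: in_idealD.
by rewrite -!mulNr; apply: in_idealM.
Qed.

HB.instance Definition _ :=
  GRing.isZmodClosed.Build A two_sided_ideal two_sided_ideal_closed.

Lemma mem_two_sided_ideal r : r \in rels -> r \in two_sided_ideal.
Proof.
move=> rr; apply/two_sided_idealP; rewrite -[r]mul1r -[1 * r]mulr1.
exact: in_idealM.
Qed.

Lemma two_sided_idealMl a x :
  x \in two_sided_ideal -> a * x \in two_sided_ideal.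
Proof.
move=> /two_sided_idealP Ix; apply/two_sided_idealP.
elim: Ix => [|u v _ IHu _ IHv|c r b rr]; first by rewrite mulr0; constructor.
  by rewrite mulrDr; apply: in_idealD.
by rewrite !mulrA; apply: in_idealM.
Qed.

Lemma two_sided_idealMr b x :
  x \in two_sided_ideal -> x * b \in two_sided_ideal.
Proof.
move=> /two_sided_idealP Ix; apply/two_sided_idealP.
elim: Ix => [|u v _ IHu _ IHv|a r c rr]; first by rewrite mul0r; constructor.
  by rewrite mulrDl; apply: in_idealD.
by rewrite -mulrA; apply: in_idealM.
Qed.

End TwoSidedIdeal.

Inductive gen := Y1 | Y2 | G | Ginv.

Definition gen_code x : 'I_4 := inord (match x with Y1 => 0 | Y2 => 1 | G => 2 | Ginv => 3 end).
Definition gen_decode (i : 'I_4) :=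
  match val i with 0 => Y1 | 1 => Y2 | 2 => G | _ => Ginv end.
Lemma gen_codeK : cancel gen_code gen_decode.
Proof. by case; rewrite /gen_decode /gen_code /= inordK. Qed.
HB.instance Definition _ := Choice.copy gen (can_type gen_codeK).

Lemma malg_scalerAr (K : monomType) (R : comNzRingType) (c : R) (x y : {malg R[K]}) :
  c *: (x * y) = x * (c *: y).
Proof.
apply/malgP => m; rewrite mcoeffZ !(@mcoeffMlw _ _ (msupp x) (msupp y)) ?msuppZ_le //.
rewrite mulr_sumr; apply: eq_bigr => i _; rewrite mulr_sumr; apply: eq_bigr => j _.
by rewrite mcoeffZ mulrnAr mulrCA.
Qed.

Section FreeAlgebra.
Variable k : fieldType.

(* The free associative algebra on [gen]: finitely supported functions on
   words, with the convolution product. *)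
Definition free_alg := {malg k[{fmonom gen}]}.
HB.instance Definition _ := GRing.Lalgebra.on free_alg.

Definition fgen (x : gen) : free_alg := << 1 *g fmu x >>.

HB.instance Definition _ :=
  GRing.Lalgebra_isAlgebra.Build k free_alg (@malg_scalerAr _ k).

Section Eval.
Variables (S : algType k) (f : gen -> S).

Definition word_eval (m : {fmonom gen}) : S := \prod_(x <- m) f x.
Lemma word_eval_mmorphism : mmorphism word_eval.
Proof.
split=> [m n|]; rewrite /word_eval; first by rewrite fmM big_cat.
by rewrite fm1 big_nil.
Qed.
HB.instance Definition _ :=
  isMultiplicative.Build {fmonom gen} S word_eval word_eval_mmorphism.

Definition free_eval (x : free_alg) : S := mmap (in_alg S) word_eval x.

Lemma free_eval_zmod : zmod_morphism free_eval.
Proof. by move=> x y; rewrite /free_eval raddfB. Qed.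
HB.instance Definition _ :=
  GRing.isZmodMorphism.Build free_alg S free_eval free_eval_zmod.
Lemma free_eval_monoid : monoid_morphism free_eval.
Proof.
have [|hM h1] := @commr_mmap_is_multiplicative _ _ _ (in_alg S) word_eval.
  by move=> g m m'; rewrite /GRing.comm /= mulr_algl mulr_algr.
by split.
Qed.
HB.instance Definition _ :=
  GRing.isMonoidMorphism.Build free_alg S free_eval free_eval_monoid.
Lemma free_evalZ : scalable free_eval.
Proof. by move=> c x; rewrite /free_eval mmapZ /= mulr_algl. Qed.
HB.instance Definition _ :=
  GRing.isScalable.Build k free_alg S *:%R free_eval free_evalZ.

Lemma free_eval_gen x : free_eval (fgen x) = f x.
Proof.
by rewrite /free_eval /fgen mmapU /= scale1r mul1r /word_eval fmU big_seq1.
Qed.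

End Eval.
End FreeAlgebra.

Section Relations.
Variables (k : fieldType).

Definition relators (A : algType k) (f : gen -> A) : seq A :=
  [:: f G * f Ginv - 1;
      f Ginv * f G - 1;
      f Y2 * f Y1 - f Y1 * f Y2 + 2^-1 *: f Y1 ^+ 2;
      f G * f Y1 * f Ginv - f Y1;
      f G * f Y2 * f Ginv - (f Y1 + f Y2)].

Definition satisfies (A : algType k) (f : gen -> A) :=
  forall r, r \in relators f -> r = 0.

Lemma map_relators (A B : algType k) (phi : {lrmorphism A -> B}) (f : gen -> A) :
  [seq phi r | r <- relators f] = relators (phi \o f).
Proof.
rewrite /relators /= !rmorphD !rmorphN !rmorphM !rmorph1 /= linearZ /=.
by rewrite rmorphXn rmorphD.
Qed.

Definition rel_ideal : {pred free_alg k} := two_sided_ideal (relators (@fgen k)).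
HB.instance Definition _ := GRing.ZmodClosed.on rel_ideal.

Lemma free_eval_relators (A : algType k) (f : gen -> A) :
  [seq free_eval f r | r <- relators (@fgen k)] = relators f.
Proof.
by rewrite map_relators; congr relators; apply/funext/free_eval_gen.
Qed.

Lemma free_eval_ideal (A : algType k) (f : gen -> A) (x : free_alg k) :
  satisfies f -> x \in rel_ideal -> free_eval f x = 0.
Proof.
move=> sf /two_sided_idealP; elim=> [|u v _ IHu _ IHv|a r b rr].
- by rewrite raddf0.
- by rewrite raddfD /= IHu IHv addr0.
rewrite !rmorphM /= (sf (free_eval f r)) ?mulr0 ?mul0r //.
by rewrite -free_eval_relators map_f.
Qed.

Definition char_gen (a b : k) (x : gen) : k^o :=
  match x with Y1 => 0 | Y2 => b | G => a | Ginv => a^-1 end.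

Lemma char_gen_satisfies a b : a != 0 -> satisfies (char_gen a b).
Proof.
move=> a0 r; rewrite !inE /= => /or4P[/eqP->|/eqP->|/eqP->|/orP[]/eqP->].
- by rewrite divff ?subrr.
- by rewrite mulVf ?subrr.
- by rewrite mulr0 mul0r subr0 expr0n scaler0 addr0.
- by rewrite mulr0 mul0r subr0.
by rewrite mulrAC divff // mul1r add0r subrr.
Qed.

End Relations.

Section Algebra.
Variable k : fieldType.

Definition H : Type := Quotient.quot (@rel_ideal k).
HB.instance Definition _ := GRing.Zmodule.on H.
HB.instance Definition _ := EqQuotient.on H.

Definition Hpi (x : free_alg k) : H := \pi_H x.

Lemma Hpi_eq x y : (Hpi x = Hpi y) <-> (x - y \in @rel_ideal k).
Proof.
rewrite (@Quotient.idealrBE _ (@rel_ideal k)); split; first by move/eqP.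
by move/eqP.
Qed.

Lemma Hpi_reprK (h : H) : Hpi (repr h) = h.
Proof. exact: reprK. Qed.

Lemma Hpi_zmod : zmod_morphism Hpi.
Proof. by move=> x y; rewrite /Hpi !piE. Qed.
HB.instance Definition _ :=
  GRing.isZmodMorphism.Build (free_alg k) H Hpi Hpi_zmod.

Lemma HpiD : {morph Hpi : x y / x + y}.
Proof. by move=> x y; rewrite raddfD. Qed.

Definition Hone : H := Hpi 1.
Definition Hmul (x y : H) : H := Hpi (repr x * repr y).
Definition Hscale (c : k) (x : H) : H := Hpi (c *: repr x).

Lemma HpiM x y : Hmul (Hpi x) (Hpi y) = Hpi (x * y).
Proof.
apply/Hpi_eq.
have /Hpi_eq Ix := Hpi_reprK (Hpi x); have /Hpi_eq Iy := Hpi_reprK (Hpi y).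
set x' := repr _ in Ix *; set y' := repr _ in Iy *.
have -> : x' * y' - x * y = (x' - x) * y' + x * (y' - y).
  by rewrite mulrBl mulrBr addrA subrK.
by apply: rpredD; [apply: two_sided_idealMr|apply: two_sided_idealMl].
Qed.

Lemma HpiZ c x : Hscale c (Hpi x) = Hpi (c *: x).
Proof.
apply/Hpi_eq; have /Hpi_eq Ix := Hpi_reprK (Hpi x).
by rewrite -scalerBr -mulr_algl; apply: two_sided_idealMl.
Qed.

Lemma H_ind (P : H -> Prop) : (forall x, P (Hpi x)) -> forall h, P h.
Proof. by move=> Px h; rewrite -[h]Hpi_reprK. Qed.

Lemma HmulA : associative Hmul.
Proof. by do 3!elim/H_ind => ?; rewrite !HpiM mulrA. Qed.
Lemma Hmul1r : left_id Hone Hmul.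
Proof. by elim/H_ind => ?; rewrite HpiM mul1r. Qed.
Lemma Hmulr1 : right_id Hone Hmul.
Proof. by elim/H_ind => ?; rewrite HpiM mulr1. Qed.
Lemma HmulDl : left_distributive Hmul +%R.
Proof. by do 3!elim/H_ind => ?; rewrite -[in LHS]HpiD !HpiM -HpiD mulrDl. Qed.
Lemma HmulDr : right_distributive Hmul +%R.
Proof. by do 3!elim/H_ind => ?; rewrite -[in LHS]HpiD !HpiM -HpiD mulrDr. Qed.
Lemma Hone_neq0 : Hone != 0.
Proof.
apply/eqP; rewrite -(raddf0 Hpi) => /Hpi_eq; rewrite subr0.
move/(free_eval_ideal (@char_gen_satisfies k 1 0 (oner_neq0 k)))/eqP.
by rewrite rmorph1 oner_eq0.
Qed.
HB.instance Definition _ := GRing.Zmodule_isNzRing.Build H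
  HmulA Hmul1r Hmulr1 HmulDl HmulDr Hone_neq0.

Lemma HscaleA a b v : Hscale a (Hscale b v) = Hscale (a * b) v.
Proof. by elim/H_ind: v => ?; rewrite !HpiZ scalerA. Qed.
Lemma Hscale1 : left_id 1 Hscale.
Proof. by elim/H_ind => ?; rewrite HpiZ scale1r. Qed.
Lemma HscaleDr : right_distributive Hscale +%R.
Proof. by move=> c; do 2!elim/H_ind => ?; rewrite -[in LHS]HpiD !HpiZ -HpiD scalerDr. Qed.
Lemma HscaleDl v : {morph Hscale^~ v : a b / a + b}.
Proof. by move=> a b; elim/H_ind: v => ?; rewrite !HpiZ -HpiD scalerDl. Qed.
HB.instance Definition _ := GRing.Zmodule_isLmodule.Build k H
  HscaleA Hscale1 HscaleDr HscaleDl.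

Lemma HscaleAl (a : k) (u v : H) : a *: (u * v) = (a *: u) * v.
Proof.
elim/H_ind: u => u; elim/H_ind: v => v; rewrite /GRing.mul /GRing.scale /=.
by rewrite !(HpiM, HpiZ) scalerAl.
Qed.
HB.instance Definition _ := GRing.Lmodule_isLalgebra.Build k H HscaleAl.
Lemma HscaleAr (a : k) (u v : H) : a *: (u * v) = u * (a *: v).
Proof.
elim/H_ind: u => u; elim/H_ind: v => v; rewrite /GRing.mul /GRing.scale /=.
by rewrite !(HpiM, HpiZ) scalerAr.
Qed.
HB.instance Definition _ := GRing.Lalgebra_isAlgebra.Build k H HscaleAr.

Lemma Hpi_monoid : monoid_morphism Hpi.
Proof. split=> [|x y]; [reflexivity|exact: (esym (HpiM x y))]. Qed.
HB.instance Definition _ :=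
  GRing.isMonoidMorphism.Build (free_alg k) H Hpi Hpi_monoid.
Lemma Hpi_scalable : scalable Hpi.
Proof. move=> c x; exact: (esym (HpiZ c x)). Qed.
HB.instance Definition _ :=
  GRing.isScalable.Build k (free_alg k) H *:%R Hpi Hpi_scalable.

Definition Hgen (x : gen) : H := Hpi (fgen k x).

Lemma Hgen_satisfies : satisfies Hgen.
Proof.
have E : relators Hgen = [seq Hpi r | r <- relators (@fgen k)].
  by rewrite map_relators.
move=> r; rewrite E => /mapP[s rs ->]; rewrite -(raddf0 Hpi); apply/Hpi_eq.
by rewrite subr0; apply: mem_two_sided_ideal.
Qed.

(* Universal property of the presentation: [Hlift f] is the algebra morphism
   determined by [f], provided that [f] satisfies the relations. *)
Section Lift.
Variables (A : algType k) (f : gen -> A).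

Definition Hlift (h : H) : A := free_eval f (repr h).

Hypothesis sf : satisfies f.

Lemma Hlift_pi x : Hlift (Hpi x) = free_eval f x.
Proof.
have /Hpi_eq/(free_eval_ideal sf) := Hpi_reprK (Hpi x).
by rewrite raddfB => /eqP; rewrite subr_eq0 => /eqP.
Qed.
Lemma Hlift_gen x : Hlift (Hgen x) = f x.
Proof. by rewrite Hlift_pi free_eval_gen. Qed.
Lemma Hlift_zmod : zmod_morphism Hlift.
Proof. by do 2!elim/H_ind=> ?; rewrite -raddfB !Hlift_pi raddfB. Qed.
Lemma HliftD : {morph Hlift : x y / x + y}.
Proof. by do 2!elim/H_ind=> ?; rewrite -HpiD !Hlift_pi raddfD. Qed.
Lemma Hlift_monoid : monoid_morphism Hlift.
Proof.
split; first by rewrite -(rmorph1 Hpi) Hlift_pi rmorph1.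
by do 2!elim/H_ind=> ?; rewrite -rmorphM !Hlift_pi rmorphM.
Qed.
Lemma Hlift_scalable : scalable Hlift.
Proof. by move=> c; elim/H_ind=> ?; rewrite -linearZ !Hlift_pi linearZ. Qed.
End Lift.

Lemma Hgen_ext (A : algType k) (u v : {lrmorphism H -> A}) :
  (forall x, u (Hgen x) = v (Hgen x)) -> u =1 v.
Proof.
move=> uv; elim/H_ind => x; rewrite [x]monalgE !linear_sum /=.
apply: eq_bigr => m _; set c := x@_m.
have -> : << c *g m >> = c *: \prod_(i <- m) fgen k i :> free_alg k.
  case: m {c} (c) => s c; elim: s c => [|i s IHs] c.
    by rewrite big_nil -fmoneE -mul_malgC mulr1.
  rewrite big_cons scalerAr -IHs /fgen malgM_def fgmulUU mul1r; congr mkmalgU.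
  by apply/eqP; rewrite fmP fmM fmU.
rewrite !linearZ /= !rmorph_prod; congr (_ *: _).
by apply: eq_bigr => i _; apply: uv.
Qed.

End Algebra.

Section Borel.
Variable k : fieldType.

Definition borel_mx (a b : k) : 'M[k]_2 :=
  \matrix_(i, j) if i == 0 then (if j == 0 then a else b)
                 else (if j == 0 then 0 else a^-1).

Definition borel : {pred 'M[k]_2} :=
  [pred M | `[< exists a b : k, a != 0 /\ M = borel_mx a b >]].

Definition borelType := {M : 'M[k]_2 | M \in borel}.

Lemma borel00_neq0 (c : borelType) : val c 0 0 != 0.
Proof. by case: c => M /= /asboolP[a [b [a0 ->]]]; rewrite mxE. Qed.

End Borel.

(* The argument [c] is phantom in the carrier: it selects the H-action. *)
Definition kgamma (k : fieldType) (c : borelType k) : Type := k.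

Section OneDimensional.
Variables (k : fieldType) (c : borelType k).

Definition kgamma_char : H k -> k^o :=
  Hlift (char_gen (val c 0 0) (val c 0 1)).

Let sat := @char_gen_satisfies k _ (val c 0 1) (borel00_neq0 c).

HB.instance Definition _ := GRing.Zmodule.on (kgamma c).

Definition kgamma_scale (h : H k) (v : kgamma c) : kgamma c := kgamma_char h * v.

Lemma kgamma_scaleA a b v :
  kgamma_scale a (kgamma_scale b v) = kgamma_scale (a * b) v.
Proof.
by rewrite /kgamma_scale /kgamma_char (Hlift_monoid sat).2 -mulrA.
Qed.
Lemma kgamma_scale1 : left_id 1 kgamma_scale.
Proof.
by move=> v; rewrite /kgamma_scale /kgamma_char (Hlift_monoid sat).1 mul1r.
Qed.
Lemma kgamma_scaleDr : right_distributive kgamma_scale +%R.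
Proof. by move=> h u v; rewrite /kgamma_scale mulrDr. Qed.
Lemma kgamma_scaleDl v : {morph kgamma_scale^~ v : a b / a + b}.
Proof.
move=> a b; rewrite /kgamma_scale /kgamma_char.
by rewrite (HliftD sat) mulrDl.
Qed.
HB.instance Definition _ := GRing.Zmodule_isLmodule.Build (H k) (kgamma c)
  kgamma_scaleA kgamma_scale1 kgamma_scaleDr kgamma_scaleDl.

Lemma kgammaE (x : gen) (v : kgamma c) :
  Hgen k x *: v =
    match x with
    | Y1 => 0 | Y2 => val c 0 1 | G => val c 0 0 | Ginv => (val c 0 0)^-1
    end * (v : k) :> k.
Proof.
rewrite [LHS]/(kgamma_scale _ _) /kgamma_scale /kgamma_char (Hlift_gen sat).
by case: x.
Qed.

Lemma kgamma_algE (a : k) (v : kgamma c) : (a%:A : H k) *: v = a * (v : k) :> k.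
Proof.
rewrite [LHS]/(kgamma_scale _ _) /kgamma_scale /kgamma_char.
by rewrite (Hlift_scalable sat) (Hlift_monoid sat).1 /= /GRing.scale /= mulr1.
Qed.

End OneDimensional.

Definition module_iso (R : nzRingType) (V W : lmodType R) :=
  exists f : {linear V -> W}, bijective f.

Definition irreducible_module (R : nzRingType) (V : lmodType R) :=
  (exists v : V, v != 0) /\
  forall S : {pred V}, submod_closed S -> S =i pred1 0 \/ S =i predT.

Section RestrictionOfScalars.
Variables (k : fieldType) (A : algType k) (V : lmodType A).

Definition restr_scalars : Type := V.
HB.instance Definition _ := GRing.Zmodule.on restr_scalars.

Definition restr_scale (a : k) (v : restr_scalars) : restr_scalars :=
  (a%:A : A) *: (v : V).

Lemma restr_scaleA a b v :
  restr_scale a (restr_scale b v) = restr_scale (a * b) v.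
Proof. by rewrite /restr_scale scalerA mulr_algl scalerA. Qed.
Lemma restr_scale1 : left_id 1 restr_scale.
Proof. by move=> v; rewrite /restr_scale !scale1r. Qed.
Lemma restr_scaleDr : right_distributive restr_scale +%R.
Proof. by move=> a u v; rewrite /restr_scale scalerDr. Qed.
Lemma restr_scaleDl v : {morph restr_scale^~ v : a b / a + b}.
Proof. by move=> a b; rewrite /restr_scale !scalerDl. Qed.
HB.instance Definition _ := GRing.Zmodule_isLmodule.Build k restr_scalars
  restr_scaleA restr_scale1 restr_scaleDr restr_scaleDl.

Definition finite_dimensional :=
  exists n, module_iso restr_scalars 'rV[k]_n.

End RestrictionOfScalars.

(* Main.v *)
(* The relations make the kernel of y1 a submodule, so on an irreducible V
   either y1 = 0 or y1 is invertible.  In the latter case multiplying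
   y2 y1 - y1 y2 = - y1^2 / 2 by y1^-2 and taking traces gives dim V / 2 = 0,
   impossible in characteristic 0.  Hence y1 = 0, so g and y2 commute with
   the action of H and act by scalars by Schur's lemma, and every line is a submodule.
   The scalars of g and y2 are invariants of V, whence uniqueness. *)
Require Import Defs.
From HB Require Import structures.
From mathcomp Require Import all_boot all_algebra.
From mathcomp Require Import boolp finmap.
From mathcomp.multinomials Require Import monalg.

Set Implicit Arguments.
Unset Strict Implicit.
Unset Printing Implicit Defensive.

Import GRing.Theory.
Local Open Scope ring_scope.

(** Multiplied on the right by [A]^-2, the commutator becomes [B] [A]^-1 - [A] [B] [A]^-2, whose
    trace vanishes by cyclicity; what remains is [c] times the trace of the identity. *)
Lemma unitmx_jordan_relation (k : fieldType) n (A B : 'M[k]_n) (c : k) :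
  A \in unitmx -> B *m A = A *m B + c *: (A *m A) -> c * n%:R = 0.
Proof.
move=> uA rel; rewrite -mxtrace1 -mxtraceZ.
have -> : c *: 1%:M = (c *: (A *m A)) *m invmx A *m invmx A.
  by rewrite -!scalemxAl mulmxK // mulmxV.
have -> : c *: (A *m A) = B *m A - A *m B by rewrite rel addrC addKr.
rewrite !mulmxBl mulmxK // raddfB /=.
by rewrite -!(mulmxA A) (mxtrace_mulC A) mulmxKV // subrr.
Qed.

(** * Induction over [H k] and the submodule criterion *)

Section HModules.
Variable k : fieldType.

(** Words in the generators span [H k] over [k], and each word arises from 1 by left multiplications
    by generators. *)
Lemma H_gen_ind (P : H k -> Prop) :
    P 1 -> (forall x y, P x -> P y -> P (x + y)) ->
    (forall (a : k) x, P x -> P (a *: x)) ->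
    (forall x h, P h -> P (Hgen k x * h)) ->
  forall h, P h.
Proof.
move=> P1 PD PZ PM; elim/H_ind => x; rewrite [x]monalgE linear_sum /=.
(* The empty sum is covered by [P 1], since 0 is 0 times 1. *)
apply: (big_ind P) => [|//|m _]; first by rewrite -(scale0r 1); apply: PZ.
set c := x@_m.
have -> : << c *g m >> = c *: \prod_(i <- m) fgen k i :> free_alg k.
  case: m {c} (c) => s c; elim: s c => [|i s IHs] c.
    by rewrite big_nil -fmoneE -mul_malgC mulr1.
  rewrite big_cons scalerAr -IHs /fgen malgM_def fgmulUU mul1r; congr mkmalgU.
  by apply/eqP; rewrite fmP fmM fmU.
rewrite linearZ /= rmorph_prod; apply: PZ.
case: m {c} => s; elim: s => [|i s IHs]; first by rewrite big_nil.
by rewrite big_cons; apply: PM.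
Qed.

Variable V : lmodType (H k).
Implicit Types (u v : V) (h : H k).

(** On an [H k]-module, [k] acts through the elements [a%:A], which are central. *)
Lemma scaler_algC (a : k) h v : h *: ((a%:A : H k) *: v) = a%:A *: (h *: v).
Proof. by rewrite !scalerA mulr_algl mulr_algr. Qed.

Lemma scaler_algZ (a : k) h v : (a *: h) *: v = (a%:A : H k) *: (h *: v).
Proof. by rewrite -[in LHS]mulr_algl -scalerA. Qed.

Lemma alg_scalerA (a b : k) v :
  (a%:A : H k) *: ((b%:A : H k) *: v) = ((a * b)%:A : H k) *: v.
Proof.
exact: etrans (esym (scaler_algZ _ _ _)) (congr1 (fun h => h *: v) (scalerA a b 1)).
Qed.

(** By [H_gen_ind], a [k]-subspace stable under the generators is a submodule. It is applied below
    to the kernel of [Y1], to eigenspaces and to a line. *)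
Lemma irreducible_subspace (P : V -> Prop) :
    irreducible_module V -> P 0 ->
    (forall u v, P u -> P v -> P (u + v)) ->
    (forall (a : k) u, P u -> P ((a%:A : H k) *: u)) ->
    (forall x u, P u -> P (Hgen k x *: u)) ->
  forall v, v != 0 -> P v -> forall u, P u.
Proof.
move=> [_ irr] P0 PD PZ PM v v0 Pv u.
have closedP : submod_closed [pred w : V | `[< P w >]].
  split=> [|h w z /asboolP Pw /asboolP Pz]; apply/asboolP => //.
  apply: (PD) => //; elim/H_gen_ind: h => [|x y Px Py|a x Px|x h Ph].
  - by rewrite scale1r.
  - by rewrite scalerDl; apply: PD.
  - by rewrite scaler_algZ; apply: PZ.
  - by rewrite -scalerA; apply: PM.
have [/(_ v)|/(_ u)] := irr _ closedP; rewrite !inE.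
  by move/asboolP: Pv => ->; rewrite (negPf v0).
by move/asboolP.
Qed.

(** * Modules on which [H k] acts through a character *)

Lemma kgamma_char_gen (c : borelType k) x :
  kgamma_char c (Hgen k x) = char_gen (val c 0 0) (val c 0 1) x.
Proof. exact/Hlift_gen/char_gen_satisfies/borel00_neq0. Qed.

Lemma scalar_action (c : borelType k) :
    (forall x v,
       Hgen k x *: v = ((char_gen (val c 0 0) (val c 0 1) x : k)%:A : H k) *: v) ->
  forall h v, h *: v = ((kgamma_char c h : k)%:A : H k) *: v.
Proof.
move=> act h; have sat := @char_gen_satisfies k _ (val c 0 1) (borel00_neq0 c).
pose chi h : k := kgamma_char c h.
have chi1 : chi 1 = 1 := (Hlift_monoid sat).1.
have chiD x y : chi (x + y) = chi x + chi y := HliftD sat x y.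
have chiM x y : chi (x * y) = chi x * chi y := (Hlift_monoid sat).2 x y.
have chiZ a x : chi (a *: x) = a * chi x := Hlift_scalable sat a x.
rewrite -/(chi _); elim/H_gen_ind: h => [|x y IHx IHy|a x IHx|x h IHh] v.
- by rewrite chi1 !scale1r.
- by rewrite chiD scalerDl IHx IHy -scalerDl -scalerDl.
- apply: etrans (scaler_algZ a x v) _; rewrite chiZ.
  exact: etrans (congr1 _ (IHx v)) (alg_scalerA _ _ _).
rewrite chiM -scalerA IHh act -kgamma_char_gen; exact: alg_scalerA.
Qed.

Lemma module_iso_char (c : borelType k) : module_iso V (kgamma c) ->
  forall h v, h *: v = ((kgamma_char c h : k)%:A : H k) *: v.
Proof.
move=> [f /bij_inj f_inj] h v; apply: f_inj; rewrite !linearZ /=.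
by rewrite kgamma_algE.
Qed.

Lemma borel_eq (c c' : borelType k) :
  val c 0 0 = val c' 0 0 -> val c 0 1 = val c' 0 1 -> c = c'.
Proof.
move=> e0 e1; apply: val_inj; case: c c' e0 e1 => M /= /asboolP[a [b [_ ->]]].
case=> M' /= /asboolP[a' [b' [_ ->]]].
by rewrite !mxE /= => -> ->.
Qed.

Lemma alg_scaler_inj (a b : k) v : v != 0 ->
  (a%:A : H k) *: v = (b%:A : H k) *: v -> a = b.
Proof.
move=> v0 /eqP; rewrite -subr_eq0 -scalerBl -scalerBl => /eqP e.
apply/eqP; rewrite -subr_eq0; apply: contraNT v0 => ab; apply/eqP.
transitivity (((a - b)^-1 *: (a - b)%:A : H k) *: v).
  by rewrite scalerA mulVf // !scale1r.
by rewrite scaler_algZ; apply: etrans (congr1 _ e) (scaler0 _ _).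
Qed.

(** Both characters can be read off from the action on [v], so they coincide; their values at [G]
    and [Y2] are the entries that determine the matrix. *)
Lemma module_iso_uniq (c c' : borelType k) v : v != 0 ->
  module_iso V (kgamma c) -> module_iso V (kgamma c') -> c = c'.
Proof.
move=> v0 /module_iso_char e /module_iso_char e'.
have E h : kgamma_char c h = kgamma_char c' h.
  exact: (alg_scaler_inj v0 (etrans (esym (e h v)) (e' h v))).
by apply: borel_eq; [move: (E (Hgen k G))|move: (E (Hgen k Y2))];
  rewrite !kgamma_char_gen.
Qed.

(** * Coordinates and matrices of the action *)

Section FiniteDimension.
Variables (n : nat) (f : {linear restr_scalars V -> 'rV[k]_n}).
Variable g : 'rV[k]_n -> restr_scalars V.
Hypotheses (fK : cancel f g) (gK : cancel g f).

Lemma coordZ (a : k) v : f ((a%:A : H k) *: v) = a *: f v.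
Proof. exact: (linearZ_LR f a (v : restr_scalars V)). Qed.

Lemma coordD u v : f (u + v : V) = f u + f v.
Proof. exact: (raddfD f). Qed.

Lemma coord_eq0 v : (f v == 0) = (v == 0).
Proof. by rewrite -(raddf0 f) (inj_eq (can_inj fK)). Qed.

Lemma coord_dim_gt0 v : v != 0 -> (0 < n)%N.
Proof.
rewrite lt0n -coord_eq0; apply: contra => /eqP n0.
by apply/eqP/rowP => -[m ltm]; exfalso; rewrite n0 in ltm.
Qed.

Lemma scalar_action_iso (c : borelType k) : irreducible_module V ->
    (forall h v, h *: v = ((kgamma_char c h : k)%:A : H k) *: v) ->
  module_iso V (kgamma c).
Proof.
move=> irr act; have [v0 nz_v0] := irr.1.
have [i fi] : exists i, f v0 0 i != 0.
  by apply/rV0Pn; rewrite coord_eq0.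
(* Since [H k] acts by scalars, the line through [v0] is a nonzero submodule. *)
have span v : exists t : k, v = (t%:A : H k) *: v0.
  pose P w := exists t : k, w = (t%:A : H k) *: v0.
  apply: (irreducible_subspace (P := P) irr _ _ _ _ nz_v0)
    => [|u w [s ->] [t ->]|a u [t ->]|x u [t ->]|].
  - by exists 0; rewrite !scale0r.
  - by exists (s + t); rewrite !scalerDl.
  - exists (a * t); exact: alg_scalerA.
  - eexists; rewrite scaler_algC act; exact: alg_scalerA.
  - by exists 1; rewrite !scale1r.
(* The coefficient of [v] on [v0], read at a coordinate where [v0] does not vanish. *)
pose F (v : V) : kgamma c := f v 0 i / f v0 0 i.
have F_lin : linear F.
  by move=> h u v; rewrite /F coordD act coordZ !mxE mulrDl -mulrA.
pose FL := GRing.isLinear.Build (H k) V (kgamma c) _ F F_lin.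
pose Flin : {linear V -> kgamma c} := HB.pack F FL.
exists Flin; exists (fun t : kgamma c => ((t : k)%:A : H k) *: v0) => [v|t] /=.
  have [t vE] := span v.
  have Ft : F v = t by rewrite /F [in LHS]vE (coordZ t v0) mxE mulfK.
  exact: etrans (congr1 (fun s : k => (s%:A : H k) *: v0) Ft) (esym vE).
by rewrite /F coordZ mxE mulfK.
Qed.

Definition act_fun h (u : 'rV[k]_n) : 'rV[k]_n := f (h *: (g u : V)).

Lemma act_fun_linear h : linear (act_fun h).
Proof.
move=> a u v; rewrite /act_fun.
have -> : g (a *: u + v) = (a%:A : H k) *: (g u : V) + g v :> V.
  by apply: (can_inj fK); rewrite gK coordD coordZ !gK.
by rewrite scalerDr coordD scaler_algC coordZ.
Qed.
HB.instance Definition _ h :=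
  GRing.isLinear.Build k 'rV[k]_n 'rV[k]_n _ (act_fun h) (act_fun_linear h).

Definition act_mx h : 'M[k]_n := lin1_mx (act_fun h).

Lemma mul_act_mx h v : f v *m act_mx h = f (h *: v).
Proof. by rewrite mul_rV_lin1 /= /act_fun fK. Qed.

Lemma eq_act_mx (A : 'M[k]_n) h :
  (forall v, f v *m A = f (h *: v)) -> A = act_mx h.
Proof.
by move=> e; apply/row_matrixP => i; rewrite !rowE -[delta_mx _ _]gK e mul_act_mx.
Qed.

Lemma eigenvalue_act_mx h (a : k) : eigenvalue (act_mx h) a ->
  exists2 v : V, v != 0 & h *: v = (a%:A : H k) *: v.
Proof.
move=> /eigenvalueP[r hr r0]; exists (g r); first by rewrite -coord_eq0 gK.
by apply: (can_inj fK); rewrite -mul_act_mx coordZ gK.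
Qed.

(* Row vectors are acted upon from the right, hence the reversal. *)
Lemma act_mxM h h' : act_mx (h * h') = act_mx h' *m act_mx h.
Proof.
by apply/esym/eq_act_mx => v; rewrite mulmxA !mul_act_mx scalerA.
Qed.

Lemma act_mxD h h' : act_mx (h + h') = act_mx h + act_mx h'.
Proof.
by apply/esym/eq_act_mx => v; rewrite mulmxDr !mul_act_mx scalerDl coordD.
Qed.

Lemma act_mxZ (a : k) h : act_mx (a *: h) = a *: act_mx h.
Proof.
by apply/esym/eq_act_mx => v; rewrite -scalemxAr mul_act_mx scaler_algZ coordZ.
Qed.

End FiniteDimension.

(** * The relations as identities of the action, and commutation once [Y1] acts by 0 *)

Lemma nth_relators i : nth 0 (relators (Hgen k)) i = 0.
Proof.
(* Past the end of the list, the default value is 0 as well. *)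
have [lti|?] := ltnP i (size (relators (Hgen k))); last exact: nth_default.
exact/Hgen_satisfies/mem_nth.
Qed.

Lemma Hgen_Y1_Y2 :
  Hgen k Y1 * Hgen k Y2 = Hgen k Y2 * Hgen k Y1 + 2^-1 *: Hgen k Y1 ^+ 2.
Proof. by have /= := nth_relators 2; rewrite addrAC => /subr0_eq ->. Qed.

Lemma act_Y1_Y2 v :
  Hgen k Y1 *: (Hgen k Y2 *: v) =
    Hgen k Y2 *: (Hgen k Y1 *: v) + (2^-1 *: Hgen k Y1 ^+ 2) *: v.
Proof. by rewrite !scalerA -scalerDl Hgen_Y1_Y2. Qed.

Lemma act_G_Ginv v : Hgen k G *: (Hgen k Ginv *: v) = v.
Proof. by have /= /subr0_eq rel := nth_relators 0; rewrite scalerA rel scale1r. Qed.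

Lemma act_Ginv_G v : Hgen k Ginv *: (Hgen k G *: v) = v.
Proof. by have /= /subr0_eq rel := nth_relators 1; rewrite scalerA rel scale1r. Qed.

Lemma act_G_Y1 v : Hgen k G *: (Hgen k Y1 *: v) = Hgen k Y1 *: (Hgen k G *: v).
Proof.
have /= /subr0_eq rel := nth_relators 3.
by rewrite -[in RHS]rel -2!scalerA act_Ginv_G.
Qed.

Lemma act_G_Y2 v : Hgen k G *: (Hgen k Y2 *: v) =
  Hgen k Y1 *: (Hgen k G *: v) + Hgen k Y2 *: (Hgen k G *: v).
Proof.
have /= /subr0_eq rel := nth_relators 4.
by rewrite -scalerDl -rel -2!scalerA act_Ginv_G.
Qed.

Section ZeroY1.
Hypothesis Y1_0 : forall v, Hgen k Y1 *: v = 0.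

Lemma act_G_Y2_comm v : Hgen k G *: (Hgen k Y2 *: v) = Hgen k Y2 *: (Hgen k G *: v).
Proof. by rewrite act_G_Y2 Y1_0 add0r. Qed.

Lemma act_G_comm x v :
  Hgen k G *: (Hgen k x *: v) = Hgen k x *: (Hgen k G *: v).
Proof.
case: x.
- exact: act_G_Y1.
- exact: act_G_Y2_comm.
- exact: erefl.
- by rewrite act_G_Ginv act_Ginv_G.
Qed.

Lemma act_Y2_comm x v :
  Hgen k Y2 *: (Hgen k x *: v) = Hgen k x *: (Hgen k Y2 *: v).
Proof.
case: x.
- by rewrite !Y1_0 scaler0.
- exact: erefl.
- exact/esym/act_G_Y2_comm.
(* Inserting [Ginv] [G] on the left reduces commutation with [Ginv] to commutation with [G]. *)
- by rewrite -[LHS]act_Ginv_G act_G_Y2_comm act_G_Ginv.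
Qed.

End ZeroY1.

(** * Vanishing of [Y1], Schur's lemma and the classification *)

Lemma irreducible_Y1 : [pchar k] =i pred0 -> finite_dimensional V ->
  irreducible_module V -> forall v, Hgen k Y1 *: v = 0.
Proof.
move=> char0 [n [f [g fK gK]]] irr.
have natE m : (m%:R == 0 :> k) = (m == 0)%N by move: m; apply/pcharf0P.
have [v v0] := irr.1.
have [[u [u0 Yu]]|inj] := pselect (exists u : V, u != 0 /\ Hgen k Y1 *: u = 0).
  apply: (irreducible_subspace irr _ _ _ _ u0 Yu) => [|w z Yw Yz|a w Yw|x w Yw].
  - exact: scaler0.
  - by rewrite scalerDr Yw Yz addr0.
  - by rewrite scaler_algC Yw scaler0.
  - have Y1Ginv (z : V) : Hgen k Y1 *: z = 0 -> Hgen k Y1 *: (Hgen k Ginv *: z) = 0.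
      by move=> Yz; rewrite -[LHS]act_Ginv_G act_G_Y1 act_G_Ginv Yz scaler0.
    case: x; last exact: Y1Ginv.
    + by rewrite Yw scaler0.
    + by rewrite act_Y1_Y2 Yw scaler0 add0r scaler_algZ -scalerA Yw !scaler0.
    + by rewrite -act_G_Y1 Yw scaler0.
exfalso; set A := act_mx f g (Hgen k Y1); set B := act_mx f g (Hgen k Y2).
(* Products are reversed by [act_mx], so [B *m A] is the matrix of [Hgen k Y1 * Hgen k Y2]. *)
have rel : B *m A = A *m B + 2^-1 *: (A *m A).
  by rewrite /A /B -!(act_mxM fK gK) Hgen_Y1_Y2 (act_mxD fK gK) (act_mxZ fK gK).
have uA : A \in unitmx.
  rewrite -row_free_unit -kermx_eq0; apply/rowV0P => r /sub_kermxP.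
  rewrite -[r]gK mul_act_mx // => /eqP; rewrite (coord_eq0 fK) => /eqP Yr.
  apply/eqP; rewrite (coord_eq0 fK).
  by apply: contra_notT inj => r0; exists (g r).
have /eqP := unitmx_jordan_relation uA rel; rewrite mulf_eq0 invr_eq0 !natE /=.
by rewrite eqn0Ngt (coord_dim_gt0 fK v0).
Qed.

End HModules.

(** The characteristic polynomial has degree [n] > 0, hence a root; the corresponding eigenspace of
    [h] is nonzero and stable under the generators, so it is all of [V]. *)
Lemma irreducible_schur (k : closedFieldType) (V : lmodType (H k)) (h : H k) :
    finite_dimensional V -> irreducible_module V ->
    (forall x (v : V), h *: (Hgen k x *: v) = Hgen k x *: (h *: v)) ->
  exists a : k, forall v : V, h *: v = (a%:A : H k) *: v.
Proof.
move=> [n [f [g fK gK]]] irr hC; have [v0 nz_v0] := irr.1.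
have /closed_rootP[a] : size (char_poly (act_mx f g h)) != 1%N.
  by rewrite size_char_poly eqSS -lt0n (coord_dim_gt0 fK nz_v0).
rewrite -eigenvalue_root_char => /(eigenvalue_act_mx fK gK)[w w0 hw].
exists a; apply: (irreducible_subspace irr _ _ _ _ w0 hw) => [|u v hu hv|b u hu|x u hu].
- by rewrite !scaler0.
- by rewrite !scalerDr hu hv.
- by rewrite (scaler_algC b h) hu; apply: scaler_algC.
- by rewrite hC hu scaler_algC.
Qed.

Theorem proposition3p3 (k : closedFieldType) (char0 : [pchar k] =i pred0)
    (V : lmodType (H k)) :
  finite_dimensional V -> irreducible_module V ->
  exists! c : borelType k, module_iso V (kgamma c).
Proof.
move=> fdV irr; have Y1_0 := irreducible_Y1 char0 fdV irr.
have [a Ga] := irreducible_schur fdV irr (act_G_comm Y1_0).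
have [b Yb] := irreducible_schur fdV irr (act_Y2_comm Y1_0).
have [v0 nz_v0] := irr.1.
(* Otherwise [G] would kill [v0], although [Ginv] undoes it. *)
have a0 : a != 0.
  apply: contra nz_v0 => /eqP a0.
  by rewrite -[v0]act_Ginv_G Ga a0 !scale0r scaler0.
have Bc : borel_mx a b \in @borel k by apply/asboolP; exists a, b.
pose c : borelType k := Sub (borel_mx a b) Bc.
have c0 : val c 0 0 = a by rewrite mxE.
have c1 : val c 0 1 = b by rewrite mxE.
have iso : module_iso V (kgamma c).
  have [n [f [g fK gK]]] := fdV.
  apply: (scalar_action_iso fK irr); apply: scalar_action.
  rewrite c0 c1; case=> v /=; [by rewrite Y1_0 !scale0r|exact: Yb|exact: Ga|].
  (* The scalar of [Ginv] follows from that of [G]: [v] = [G] [Ginv] [v] = [a] times [Ginv] [v]. *)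
  rewrite -[v in RHS]act_G_Ginv Ga.
  by apply/esym; apply: etrans (alg_scalerA _ _ _) _; rewrite mulVf // !scale1r.
by exists c; split=> // c'; apply: (module_iso_uniq nz_v0).
Qed.
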